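(* For Independent Set in the Late Accept/Reject model, the competitive ratio is at least $\frac{3\sqrt3}{2}$; that is, for every real $c<\frac{3\sqrt3}{2}$, no online algorithm in the Late Accept/Reject model is $c$-competitive.
   Context: Online Independent Set (vertex arrival). An input $\sigma$ is a finite simple undirected graph $G=(V,E)$ together with an ordering of its vertices. Vertices arrive one by one in this order; when a vertex arrives, all edges between it and previously arrived vertices are revealed. All online algorithms are deterministic: each decision depends only on the part of the input revealed so far. After each arrival the algorithm maintains a set of currently accepted vertices, which must be an independent set of the graph revealed so far. $\mathrm{ALG}(\sigma)$ is the number of accepted vertices at the end of the input, and $\mathrm{OPT}(\sigma)$ is the maximum cardinality of an independent set of $G$; the objective is maximization. Late Accept/Reject model: in each step the algorithm may accept the newly arrived vertex and any earlier vertices that have not been late-rejected, and it may remove (late-reject) accepted vertices; a late-rejected vertex can never be accepted again. An algorithm $\mathrm{ALG}$ is $c$-competitive if there is a constant $\alpha$ such that $\mathrm{OPT}(\sigma)\le c\,\mathrm{ALG}(\sigma)+\alpha$ for all inputs $\sigma$. The competitive ratio of the problem is the infimum of all $c$ for which some online algorithm is $c$-competitive. *)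

(* Defs.v *)
From mathcomp Require Import all_boot all_order all_algebra.
From mathcomp Require Import all_classical all_reals all_analysis.

Set Implicit Arguments.
Unset Strict Implicit.
Unset Printing Implicit Defensive.

Import Order.TTheory GRing.Theory Num.Theory.

(* A finite simple undirected graph together with an ordering of its vertices:
   the vertices are named by their arrival times 0, ..., n-1.  The adjacency
   relation is stored as a finite set and the axioms are boolean, so graphs
   with the same edges are equal and an algorithm cannot tell them apart. *)
Record graph (n : nat) := Graph {
  edges : {set 'I_n * 'I_n};
  edges_sym : [forall u, forall v, ((u, v) \in edges) == ((v, u) \in edges)];
  edges_irr : [forall v, (v, v) \notin edges]
}.

Definition adj n (G : graph n) : rel 'I_n := fun u v => (u, v) \in edges G.

Definition independent n (G : graph n) (S : {set 'I_n}) : bool :=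
  [forall u in S, forall v in S, ~~ adj G u v].

Definition OPT n (G : graph n) : nat :=
  \max_(S : {set 'I_n} | independent G S) #|S|.

Section Prefix.
Variables (n : nat) (G : graph n) (k : 'I_n.+1).

Let emb : 'I_k -> 'I_n := widen_ord (leq_ord k).

Definition prefix_edges : {set 'I_k * 'I_k} :=
  [set e | adj G (emb e.1) (emb e.2)].

Fact prefix_sym : [forall u, forall v,
  ((u, v) \in prefix_edges) == ((v, u) \in prefix_edges)].
Proof.
apply/forallP => u; apply/forallP => v; rewrite !inE /adj /=.
by move/forallP: (edges_sym G) => /(_ (emb u)) /forallP /(_ (emb v)).
Qed.

Fact prefix_irr : [forall v, (v, v) \notin prefix_edges].
Proof.
apply/forallP => v; rewrite !inE /adj /=.
by move/forallP: (edges_irr G) => /(_ (emb v)).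
Qed.

(* The part of the input revealed by the first k arrivals. *)
Definition prefix : graph k := Graph prefix_sym prefix_irr.

End Prefix.

(* A deterministic online algorithm maps the part of the input revealed so far
   to the set of currently accepted vertices.  Earlier decisions need not be an
   argument, being themselves determined by shorter prefixes, and the total
   number of vertices is unknown to the algorithm until the input ends. *)
Definition algorithm := forall n : nat, graph n -> {set 'I_n}.

Definition ALG (A : algorithm) n (G : graph n) : nat := #|A n G|.

Definition accepted (A : algorithm) n (G : graph n) (k : 'I_n.+1) : {set 'I_n} :=
  [set widen_ord (leq_ord k) v | v in A k (prefix G k)].

Definition late_rejected (A : algorithm) n (G : graph n) (k : 'I_n.+1) :
    {set 'I_n} :=
  [set v | [exists i : 'I_n.+1, exists j : 'I_n.+1,
     [&& i < j, j <= k, v \in accepted A G i & v \notin accepted A G j]]].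

(* A vertex that has arrived and is neither accepted nor late-rejected remains
   available for acceptance in any later step. *)
Definition late_accept_reject (A : algorithm) : Prop :=
  forall n (G : graph n),
    independent G (A n G) /\
    (forall k : 'I_n.+1, [disjoint accepted A G k & late_rejected A G k]).

Local Open Scope ring_scope.

Definition competitive (R : realType) (c : R) (A : algorithm) : Prop :=
  exists alpha : R, forall n (G : graph n),
    (OPT G)%:R <= c * (ALG A G)%:R + alpha.

Definition competitive_ratio (R : realType) : \bar R :=
  ereal_inf [set c%:E | c in
    [set c : R | exists2 A, late_accept_reject A & competitive c A]]%classic.

(* Main.v *)
(* The adversary builds layers of pairwise independent vertices; a new vertex is
   joined to every earlier vertex outside its own layer and outside a fixed
   independent set of late-rejected vertices.  Vertices that are still available
   in different layers are thus adjacent, and ALG always sits inside one layer.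
   While it sits in layer j, a fresh layer grows until ALG moves, which
   late-rejects everything it held.  If ALG only ever moves to the newest layer
   and x_t is the size of the independent set made of the rejected vertices of
   layers t, t-2, ..., competitiveness gives x_(t+1) <= c (x_t - x_(t-2)); the
   ratios x_(t+1) / x_t are then bounded by a sequence decreasing geometrically,
   because 3 sqrt 3 / 2 is the minimum of z^3 / (z^2 - 1) over z > 1.
   ALG may also return to an old layer.  Such a layer is only worse for ALG than
   at its first visit, so each layer keeps the index t as its rank; ranks are
   bounded, and giving an available vertex a weight that falls steeply with the
   rank of its layer makes the total weight decrease at each move. *)
Require Import Defs.
From mathcomp Require Import all_boot all_order all_algebra.
From mathcomp Require Import all_classical all_reals all_analysis.
From mathcomp Require Import ring lra.

Import Order.TTheory GRing.Theory Num.Theory.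
Local Open Scope ring_scope.

(** * Inputs as relations on arrival times, and the algorithm's answers to them *)

Section Play.
Set Implicit Arguments.
Unset Strict Implicit.
Local Open Scope nat_scope.

Lemma graph_inj n (G H : graph n) : edges G = edges H -> G = H.
Proof.
case: G H => [eG sG iG] [eH sH iH] /= eqE; move: sG iG; rewrite eqE => sG iG.
by rewrite (bool_irrelevance sG sH) (bool_irrelevance iG iH).
Qed.

(** [E u v] is read only for [u < v], so any relation on [nat] encodes an unbounded input, and its
    graph on [n] vertices is a prefix of all longer ones. *)
Definition back_edges (E : rel nat) n : {set 'I_n * 'I_n} :=
  [set e : 'I_n * 'I_n | (e.1 < e.2) && E e.1 e.2 || (e.2 < e.1) && E e.2 e.1].

Fact back_edges_sym (E : rel nat) n : [forall u, forall v,
  ((u, v) \in back_edges E n) == ((v, u) \in back_edges E n)].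
Proof. by apply/forallP => u; apply/forallP => v; rewrite !inE /= orbC. Qed.

Fact back_edges_irr (E : rel nat) n : [forall v, (v, v) \notin back_edges E n].
Proof. by apply/forallP => v; rewrite !inE /= ltnn. Qed.

Definition back_graph (E : rel nat) n : graph n :=
  Graph (back_edges_sym E n) (back_edges_irr E n).

Lemma eq_back_graph (E E' : rel nat) n :
  (forall u v, u < v -> v < n -> E u v = E' u v) ->
  back_graph E n = back_graph E' n.
Proof.
move=> eqE; apply: graph_inj; apply/setP => -[u v]; rewrite !inE /=.
by case: (ltngtP u v) => //= uv; rewrite !(orbF, eqE).
Qed.

Lemma prefix_back_graph (E : rel nat) n (k : 'I_n.+1) :
  Defs.prefix (back_graph E n) k = back_graph E k.
Proof.
by apply: graph_inj; apply/setP => -[u v]; rewrite /= inE /adj /= !inE.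
Qed.

Variable A : algorithm.

Definition acc (E : rel nat) n : seq nat :=
  [seq val i | i <- enum (A (back_graph E n))].

Lemma acc_ltn (E : rel nat) n v : v \in acc E n -> v < n.
Proof. by move=> /mapP[i _ ->]; exact: ltn_ord. Qed.

Lemma acc_uniq (E : rel nat) n : uniq (acc E n).
Proof. by rewrite map_inj_uniq ?enum_uniq //; apply: val_inj. Qed.

Lemma size_acc (E : rel nat) n : size (acc E n) = ALG A (back_graph E n).
Proof. by rewrite size_map -cardE. Qed.

Lemma eq_acc (E E' : rel nat) n :
  (forall u v, u < v -> v < n -> E u v = E' u v) -> acc E n = acc E' n.
Proof. by move=> /eq_back_graph eqE; rewrite /acc eqE. Qed.

Definition dead (E : rel nat) n v : bool :=
  [exists i : 'I_n.+1, exists j : 'I_n.+1,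
     [&& i < j, v \in acc E i & v \notin acc E j]].

Lemma deadP (E : rel nat) n v :
  reflect (exists i j, [/\ i < j, j <= n, v \in acc E i & v \notin acc E j])
          (dead E n v).
Proof.
apply: (iffP existsP) => [[i /existsP[j /and3P[ij vi vj]]]|].
  by exists i, j; split=> //; rewrite -ltnS.
move=> [i [j [ij jn vi vj]]].
exists (inord i); apply/existsP; exists (inord j).
by rewrite !inordK ?ltnS ?jn ?ij ?vi ?vj //; apply: leq_trans (ltnW ij) jn.
Qed.

Lemma dead_mono (E : rel nat) n k v : n <= k -> dead E n v -> dead E k v.
Proof.
move=> nk /deadP[i [j [ij jn vi vj]]]; apply/deadP; exists i, j; split=> //.
exact: leq_trans nk.
Qed.

(** The adversary may redefine [E] on vertices yet to arrive without changing the past. *)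
Lemma eq_dead (E E' : rel nat) n v :
  (forall u v, u < v -> v < n -> E u v = E' u v) -> dead E n v = dead E' n v.
Proof.
move=> eqE; apply: eq_existsb => i; apply: eq_existsb => j.
by rewrite !(@eq_acc _ E') // => u w uw wi; apply: eqE => //;
  apply: leq_trans wi _; rewrite -ltnS.
Qed.

Hypothesis A_late : late_accept_reject A.

Lemma acc_indep (E : rel nat) n u v :
  u \in acc E n -> v \in acc E n -> u < v -> ~~ E u v.
Proof.
move=> /mapP[i]; rewrite mem_enum => iA -> /mapP[j]; rewrite mem_enum => jA ->.
have [+ _] := A_late (back_graph E n).
move=> /forallP/(_ i)/implyP/(_ iA)/forallP/(_ j)/implyP/(_ jA).
by rewrite /adj !inE /= => + ij; rewrite ij negb_or => /andP[].
Qed.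

Lemma acc_not_dead (E : rel nat) n v : v \in acc E n -> ~~ dead E n v.
Proof.
move=> vn; apply/deadP => -[i [j [ij jn vi vj]]].
have mem_accepted k (w : 'I_n) : k <= n ->
    (w \in accepted A (back_graph E n) (inord k)) = (val w \in acc E k).
  move=> kn; have -> : acc E k = acc E (inord k : 'I_n.+1) by rewrite inordK.
  rewrite /accepted prefix_back_graph; apply/imsetP/mapP => -[x].
    by move=> xA ->; exists x; rewrite ?mem_enum.
  by rewrite mem_enum => xA wx; exists x => //; apply: val_inj.
have [_ /(_ (inord n))] := A_late (back_graph E n).
move=> /pred0P/(_ (Ordinal (acc_ltn vn))) /=.
rewrite mem_accepted //= vn /= inE => /existsP; apply.
exists (inord i); apply/existsP; exists (inord j).
have i_n : i <= n by apply: leq_trans (ltnW ij) jn.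
by rewrite !mem_accepted //= vi vj !inordK ?ltnS // ij jn.
Qed.

End Play.

(** * Competitiveness applied to explicit independent sets *)

Section Competitive.
Set Implicit Arguments.
Unset Strict Implicit.
Variables (R : realType) (c alpha : R) (A : algorithm).
Hypothesis A_comp : forall n (G : graph n),
  (OPT G)%:R <= c * (ALG A G)%:R + alpha.

Lemma indep_bound (E : rel nat) n (s : seq nat) : uniq s ->
    {in s, forall v, (v < n)%N} ->
    {in s &, forall u v, (u < v)%N -> ~~ E u v} ->
  (size s)%:R <= c * (size (acc A E n))%:R + alpha.
Proof.
move=> s_uniq s_lt s_ind; rewrite size_acc; apply: le_trans (A_comp _).
pose S := [set i : 'I_n | val i \in s].
have -> : size s = #|S|.
  rewrite cardE -(size_map val); apply: perm_size; apply: uniq_perm => //.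
    by rewrite map_inj_uniq ?enum_uniq //; apply: val_inj.
  move=> v; apply/idP/mapP => [vs|[i + ->]]; last by rewrite mem_enum inE.
  by exists (Ordinal (s_lt _ vs)) => //; rewrite mem_enum inE.
rewrite ler_nat /OPT; apply: (leq_bigmax_cond (P := fun S => independent _ S)
  (F := fun S : {set 'I_n} => #|S|)).
apply/forallP => u; apply/implyP; rewrite inE => us.
apply/forallP => v; apply/implyP; rewrite inE => vs.
rewrite /adj !inE /= negb_or !negb_and -!implybE.
by apply/andP; split; apply/implyP => ?; apply: s_ind.
Qed.

End Competitive.

(** * The layered adversary, for an abstract rank invariant *)

Section Adversary.
Set Implicit Arguments.
Unset Strict Implicit.
Variables (R : realType) (c c' alpha : R) (A : algorithm).
Hypothesis A_late : late_accept_reject A.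
Hypothesis A_comp : forall n (G : graph n),
  (OPT G)%:R <= c * (ALG A G)%:R + alpha.
Variable Q : nat.
(** With [Q] large, the algorithm must hold so many vertices that the slightly larger factor [c']
    absorbs [alpha] and one additional vertex. *)
Hypothesis gap : forall s : nat, Q%:R <= c * s%:R + alpha ->
  (0 < s)%N /\ c * s%:R + alpha + 1 <= c' * s%:R.
Hypothesis c'_ge0 : 0 <= c'.
Variable C : nat.
Hypothesis c'C : c' <= C%:R.
Variables (K : nat) (I : nat -> R -> R -> R -> Prop).
Hypothesis I_step : forall k (b y u d u' : R),
  0 <= b -> 0 < d -> b + d <= u -> u' <= c' * d -> I k b y u ->
  I k.+1 y (b + d) u'.
Hypothesis I_last : forall b y u : R, 0 <= b -> I K b y u -> u <= b.

Local Notation acc := (acc A).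
Local Notation dead := (dead A).

(* Vertex [v] belongs to layer [lab v], whose vertices are joined to all earlier
   vertices except those of their own layer and of the set [B (lab v)]. *)
Definition layered (lab : nat -> nat) (B : nat -> seq nat) : rel nat :=
  fun u v => (lab u != lab v) && (u \notin B (lab v)).

Definition layer (lab : nat -> nat) n j := [seq v <- iota 0 n | lab v == j].

Lemma mem_layer lab n j v : (v \in layer lab n j) = (v < n)%N && (lab v == j).
Proof. by rewrite mem_filter mem_iota /= andbC. Qed.

Lemma layer_uniq lab n j : uniq (layer lab n j).
Proof. by rewrite filter_uniq ?iota_uniq. Qed.

Lemma eq_layered lab lab' B B' n :
  (forall v, (v < n)%N -> lab v = lab' v) ->
  (forall v, (v < n)%N -> B (lab v) = B' (lab v)) ->
  forall u v, (u < v)%N -> (v < n)%N -> layered lab B u v = layered lab' B' u v.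
Proof.
move=> eq_lab eq_B u v uv vn.
by rewrite /layered eq_B // !eq_lab //; apply: ltn_trans vn.
Qed.

Lemma acc_large lab B n : (Q <= n)%N -> (forall v, (v < Q)%N -> lab v = 0%N) ->
  Q%:R <= c * (size (acc (layered lab B) n))%:R + alpha.
Proof.
move=> Qn lab0; rewrite -[Q in Q%:R](size_iota 0).
apply: (indep_bound A_comp); first exact: iota_uniq.
  by move=> v; rewrite mem_iota => /= vQ; apply: leq_trans Qn.
move=> u v; rewrite !mem_iota /= => uQ vQ _.
by rewrite /layered !lab0 ?eqxx.
Qed.

(** Vertices of different layers are adjacent unless the earlier one lies in some [B], and then it
    is dead and cannot be held. *)
Lemma acc_same_layer lab B n u v :
  (forall w, (w < n)%N -> {in B (lab w), forall x, dead (layered lab B) n x}) ->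
  u \in acc (layered lab B) n -> v \in acc (layered lab B) n -> lab u = lab v.
Proof.
move=> B_dead; wlog uv : u v / (u <= v)%N => [wl|un vn].
  by case/orP: (leq_total u v) => ? ? ?; [|symmetry]; apply: wl.
move: uv; rewrite leq_eqVlt => /orP[/eqP->//|uv].
apply/eqP; apply: contraTT (acc_not_dead A_late un) => luv.
rewrite negbK; apply: (B_dead v); first exact: acc_ltn vn.
by have := acc_indep A_late un vn uv; rewrite /layered luv negbK.
Qed.

(* The position after [n] vertices in layers [0 .. m-1]: layer [j] extends the
   dead independent set [B j], has rank [r j], and the layer grown while the
   algorithm sits in [j] will extend the dead independent set [Y j]. *)
Record position n m lab B Y (r : nat -> nat) : Prop := Position {
  pos_start : (Q <= n)%N;
  pos_lab0 : forall v, (v < Q)%N -> lab v = 0%N;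
  pos_lab : forall v, (v < n)%N -> (lab v < m)%N;
  pos_uniq : forall j, (j < m)%N -> uniq (B j) /\ uniq (Y j);
  pos_ltn : forall j v, (j < m)%N -> v \in B j ++ Y j -> (v < n)%N;
  pos_dead : forall j v, (j < m)%N -> v \in B j ++ Y j ->
    dead (layered lab B) n v;
  pos_before : forall j u v, (j < m)%N -> v \in B j -> (u < n)%N -> lab u = j ->
    (v < u)%N;
  pos_indB : forall j, (j < m)%N ->
    {in B j &, forall u v, (u < v)%N -> ~~ layered lab B u v};
  pos_indY : forall j, (j < m)%N ->
    {in Y j &, forall u v, (u < v)%N -> ~~ layered lab B u v};
  pos_rank : forall j, (j < m)%N -> (r j <= K)%N;
  pos_inv : forall j, (j < m)%N ->
    I (r j) (size (B j))%:R (size (Y j))%:R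
      (size (B j) + size (layer lab n j))%:R;
  pos_size : forall j, (j < m)%N -> (size (layer lab n j) <= Q * C ^ r j)%N
}.

(** The base exceeds the size of any fresh layer, so one vertex outweighs a whole layer of the next
    rank. *)
Definition weight n lab B (r : nat -> nat) : nat :=
  (\sum_(0 <= v < n | ~~ dead (layered lab B) n v)
     (Q * C ^ K).+1 ^ (K - r (lab v)))%N.

(** * One move of the algorithm away from layer [j] *)

Section Visit.
Variables (n m : nat) (lab : nat -> nat) (B Y : nat -> seq nat).
Variable r : nat -> nat.
Hypothesis pos : position n m lab B Y r.
Variable j : nat.
Hypothesis jm : (j < m)%N.
Hypothesis acc_j : {in acc (layered lab B) n, forall v, lab v = j}.

(** All vertices from time [n] on go to the fresh layer [m], so [E'] describes its growth for an
    arbitrary length. *)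
Let lab' v := if (v < n)%N then lab v else m.
Let B' i := if i == m then Y j else B i.
Let E' := layered lab' B'.

Let lab'E v : (v < n)%N -> lab' v = lab v.
Proof. by rewrite /lab' => ->. Qed.

Let B'E i : (i < m)%N -> B' i = B i.
Proof. by rewrite /B' => im; rewrite ltn_eqF. Qed.

Let B'm : B' m = Y j.
Proof. by rewrite /B' eqxx. Qed.

Let lab'_lt v : (lab' v < m)%N = (v < n)%N.
Proof.
rewrite /lab'; case: ifP => [vn|_]; last by rewrite ltnn.
exact: (pos_lab pos).
Qed.

Let E'E u v : (u < v)%N -> (v < n)%N -> layered lab B u v = E' u v.
Proof.
apply: eq_layered => w wn; first by rewrite lab'E.
by rewrite B'E ?(pos_lab pos).
Qed.

Let dead_E' k v : dead (layered lab B) n v -> dead E' (n + k) v.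
Proof.
by rewrite (@eq_dead _ _ E' n v E'E); apply: dead_mono; rewrite leq_addr.
Qed.

Let B'_dead k i : (i <= m)%N -> {in B' i, forall x, dead E' (n + k) x}.
Proof.
move=> im x xB; apply: dead_E'; move: im xB.
rewrite leq_eqVlt => /predU1P[->|im].
  by rewrite B'm => xY; apply: (pos_dead pos jm); rewrite mem_cat xY orbT.
by rewrite B'E // => xB; apply: (pos_dead pos im); rewrite mem_cat xB.
Qed.

Let lab'_le v : (lab' v <= m)%N.
Proof.
rewrite /lab'; case: ifP => // vn; apply: ltnW; exact: (pos_lab pos).
Qed.

Let acc'_same k u v :
  u \in acc E' (n + k) -> v \in acc E' (n + k) -> lab' u = lab' v.
Proof. by apply: acc_same_layer => w _; apply: B'_dead. Qed.

Let acc'_large k :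
  Q%:R <= c * (size (acc E' (n + k)))%:R + alpha.
Proof.
apply: acc_large => [|v vQ].
  exact: leq_trans (pos_start pos) (leq_addr _ _).
by rewrite lab'E ?(pos_lab0 pos) //; apply: leq_trans vQ (pos_start pos).
Qed.

Let stays k := all (fun v => lab' v == j) (acc E' (n + k)).

Let stays_sub k : stays k -> {subset acc E' (n + k) <= layer lab n j}.
Proof.
move=> /allP st v /[dup] /st /eqP vj va.
have vn : (v < n)%N by rewrite -lab'_lt vj.
by rewrite mem_layer vn -lab'E // vj eqxx.
Qed.

Let base_indep k :
  {in Y j ++ iota n k &, forall u v, (u < v)%N -> ~~ E' u v}.
Proof.
move=> u v; rewrite !mem_cat !mem_iota => uY vY uv.
have Yn w : w \in Y j -> (w < n)%N.
  by move=> wY; apply: (pos_ltn pos jm); rewrite mem_cat wY orbT.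
case/orP: vY => [vY|/andP[nv _]].
  rewrite -E'E ?Yn //; apply: (pos_indY pos jm) => //.
  case/orP: uY => // /andP[nu _]; have := Yn _ vY.
  by rewrite ltnNge ltnW // (leq_ltn_trans nu).
have labv : lab' v = m by rewrite /lab' ltnNge nv.
rewrite /E' /layered labv B'm; case/orP: uY => [->|/andP[nu _]].
  by rewrite andbF.
by rewrite /lab' ltnNge nu eqxx.
Qed.

Let base_uniq k : uniq (Y j ++ iota n k).
Proof.
rewrite cat_uniq iota_uniq andbT (proj2 (pos_uniq pos jm)) /=.
apply/hasPn => v; rewrite mem_iota => /andP[nv _]; apply: contraL nv => vY.
by rewrite -ltnNge (pos_ltn pos jm) // mem_cat vY orbT.
Qed.

(** At time [n + k] the independent set has only [k] fresh vertices. The spare 1 in [gap] pays for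
    the next one, whose arrival may make the algorithm leave. *)
Let grow k : (size (Y j) + k.+1)%:R <= c' * (size (acc E' (n + k)))%:R.
Proof.
have [_] := gap (acc'_large k); apply: le_trans.
rewrite addnS -addn1 natrD lerD2r.
have -> : (size (Y j) + k = size (Y j ++ iota n k))%N.
  by rewrite size_cat size_iota.
apply: (indep_bound A_comp) => // v.
rewrite mem_cat mem_iota => /orP[vY|/andP[]//].
by apply: ltn_addr; apply: (pos_ltn pos jm); rewrite mem_cat vY orbT.
Qed.

Let grow_nat k s : (size (acc E' (n + k)) <= s)%N ->
  (size (Y j) + k.+1 <= C * s)%N.
Proof.
move=> ks; rewrite -(ler_nat R) natrM; apply: le_trans (grow k) _.
apply: (@le_trans _ _ (C%:R * (size (acc E' (n + k)))%:R)).
  by rewrite ler_wpM2r.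
by rewrite ler_wpM2l // ler_nat.
Qed.

Let acc'_layer k : stays k -> (size (acc E' (n + k)) <= size (layer lab n j))%N.
Proof. by move=> st; apply: uniq_leq_size (acc_uniq _ _ _) (stays_sub st). Qed.

(** An algorithm staying in layer [j] holds boundedly many vertices while [grow] demands more and
    more. *)
Let leave_time : exists2 k, stays k & ~~ stays k.+1.
Proof.
have [k0 leave] : exists k, ~~ stays k.
  have [//|stay] := pselect (exists k, ~~ stays k).
  pose k := (C * size (layer lab n j))%N.
  have st : stays k by apply: contra_notT stay => st; exists k.
  by have := grow_nat (acc'_layer st); rewrite addnS ltnNge leq_addl.
have [k leave_k min_k] := ex_minnP (ex_intro (fun k => ~~ stays k) k0 leave).
case: k => [|k] in leave_k min_k *.
  move/negP: leave_k; case; rewrite /stays addn0 -(eq_acc _ E'E).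
  by apply/allP => v va; rewrite lab'E ?(acc_ltn va) // acc_j.
exists k => //; apply: contraT => leave'; have := min_k _ leave'.
by rewrite ltnn.
Qed.

Let layer_lt v : v \in layer lab n j -> (v < n)%N.
Proof. by rewrite mem_layer => /andP[]. Qed.

Let B_lt i v : (i < m)%N -> v \in B i -> (v < n)%N.
Proof. by move=> im vB; apply: (pos_ltn pos im); rewrite mem_cat vB. Qed.

Let Y_lt i v : (i < m)%N -> v \in Y i -> (v < n)%N.
Proof. by move=> im vY; apply: (pos_ltn pos im); rewrite mem_cat vY orbT. Qed.

Let layer'_old k i : (i < m)%N -> layer lab' (n + k) i = layer lab n i.
Proof.
move=> im; rewrite /layer iotaD filter_cat add0n [X in _ ++ X](_ : _ = [::]).
  rewrite cats0; apply: eq_in_filter => v; rewrite mem_iota => /= vn.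
  by rewrite lab'E.
apply/eqP; rewrite -(negbK (_ == _)) -has_filter; apply/hasPn => v.
rewrite mem_iota => /andP[nv _]; apply: contraL nv => /eqP vi.
by rewrite -ltnNge -lab'_lt vi.
Qed.

Let layer'_new k : layer lab' (n + k) m = iota n k.
Proof.
rewrite /layer iotaD filter_cat add0n [X in X ++ _](_ : _ = [::]).
  apply/all_filterP/allP => v; rewrite mem_iota => /andP[nv _].
  by rewrite /lab' ltnNge nv /=.
apply/eqP; rewrite -(negbK (_ == _)) -has_filter; apply/hasPn => v.
rewrite mem_iota => /= vn; rewrite lab'E //.
by rewrite ltn_eqF // (pos_lab pos).
Qed.

(** At rank [K] the invariant would leave layer [j] empty, yet the algorithm holds a vertex in
    it. *)
Let rj_lt : (r j < K)%N.
Proof.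
rewrite ltn_neqAle (pos_rank pos jm) andbT; apply/eqP => rjK.
have := pos_inv pos jm; rewrite rjK => /I_last; rewrite ler0n natrD => /(_ isT).
rewrite gerDl lern0; apply/negP; rewrite -lt0n.
have [k st _] := leave_time; apply: leq_trans (acc'_layer st).
by have [] := gap (acc'_large k).
Qed.

Lemma visit : exists n' m' lab' B' Y' r',
  position n' m' lab' B' Y' r' /\ (weight n' lab' B' r' < weight n lab B r)%N.
Proof.
have [k st leave] := leave_time.
(* [D] also contains vertices of layer [j] rejected on earlier visits; this covers returns to old
   layers. *)
pose D := [seq v <- layer lab n j | dead E' (n + k.+1) v].
(* If one held vertex survived the move, everything held afterwards would share its layer [j], so
   the algorithm would not have left. *)
have S_D : {subset acc E' (n + k) <= D}.
  move=> v va; rewrite mem_filter (stays_sub st) // andbT; apply/deadP.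
  exists (n + k)%N, (n + k.+1)%N; split=> //; first by rewrite addnS.
  apply: contra leave => va'; apply/allP => w wa.
  by rewrite (acc'_same wa va'); have /allP := st; apply.
have D_uniq : uniq D by rewrite filter_uniq ?layer_uniq.
have S_le : (size (acc E' (n + k)) <= size D)%N.
  exact: uniq_leq_size (acc_uniq _ _ _) S_D.
have S_gt0 : (0 < size (acc E' (n + k)))%N by have [] := gap (acc'_large k).
have D_layer v : v \in D -> v \in layer lab n j.
  by rewrite mem_filter => /andP[].
(* Layer [j] is not joined to [B j], so [B j ++ D] stays independent; it is the set reserved for the
   layer after [m]. *)
pose Y' i := if i == m then B j ++ D else Y i.
pose r' i := if i == m then (r j).+1 else r i.
have Y'm : Y' m = B j ++ D by rewrite /Y' eqxx.
have r'm : r' m = (r j).+1 by rewrite /r' eqxx.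
have Y'E i : (i < m)%N -> Y' i = Y i by rewrite /Y' => im; rewrite ltn_eqF.
have r'E i : (i < m)%N -> r' i = r i by rewrite /r' => im; rewrite ltn_eqF.
have lt_n v : (v < n)%N -> (v < n + k.+1)%N by apply: ltn_addr.
have D_le : (size D <= size (layer lab n j))%N.
  by rewrite size_filter count_size.
have k_le : (k < C * size (layer lab n j))%N.
  by apply: leq_trans (grow_nat (acc'_layer st)); apply: leq_addl.
have k_le' : (k < Q * C ^ (r j).+1)%N.
  apply: leq_trans k_le _; rewrite expnSr mulnA mulnC.
  by rewrite leq_mul2r (pos_size pos) ?orbT.
exists (n + k.+1)%N, m.+1, lab', B', Y', r'; split.
- split.
  + by apply: leq_trans (pos_start pos) _; apply: leq_addr.
  + move=> v vQ; rewrite lab'E ?(pos_lab0 pos) //.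
    exact: leq_trans vQ (pos_start pos).
  + by move=> v _; rewrite ltnS.
  + move=> i; rewrite ltnS leq_eqVlt => /predU1P[->|im]; last first.
      by rewrite B'E // Y'E //; apply: pos_uniq pos _ im.
    rewrite B'm Y'm; split; first by have [] := pos_uniq pos jm.
    rewrite cat_uniq D_uniq andbT (proj1 (pos_uniq pos jm)) /=.
    apply/hasPn => v /D_layer; rewrite mem_layer => /andP[vn /eqP vj].
    by apply/negP => /(pos_before pos jm) => /(_ _ vn vj); rewrite ltnn.
  + move=> i v; rewrite ltnS leq_eqVlt => /predU1P[->|im]; last first.
      by rewrite B'E // Y'E // => /(pos_ltn pos im)/lt_n.
    rewrite B'm Y'm !mem_cat => /or3P[/(Y_lt jm)|/(B_lt jm)|/D_layer/layer_lt];
      exact: lt_n.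
  + move=> i v; rewrite ltnS mem_cat => im /orP[/B'_dead->//|].
    move: im; rewrite leq_eqVlt => /predU1P[->|im]; last first.
      rewrite Y'E // => vY; apply: dead_E'; apply: (pos_dead pos im).
      by rewrite mem_cat vY orbT.
    rewrite Y'm mem_cat => /orP[vB|]; last by rewrite mem_filter => /andP[].
    by apply: dead_E'; apply: (pos_dead pos jm); rewrite mem_cat vB.
  + move=> i u v; rewrite ltnS leq_eqVlt => /predU1P[->|im].
      rewrite B'm => /(Y_lt jm) vn _ um; apply: leq_trans vn _.
      by rewrite leqNgt -lab'_lt um ltnn.
    rewrite B'E // => vB _ ui; have un : (u < n)%N by rewrite -lab'_lt ui.
    by apply: (pos_before pos im) => //; rewrite -lab'E.
  + move=> i; rewrite ltnS leq_eqVlt => /predU1P[->|im] u v.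
      rewrite B'm => uY vY uv; rewrite -/E' -E'E ?(Y_lt jm) //.
      exact: (pos_indY pos jm).
    rewrite B'E // => uB vB uv; rewrite -/E' -E'E ?(B_lt im) //.
    exact: (pos_indB pos im).
  + move=> i; rewrite ltnS leq_eqVlt => /predU1P[->|im] u v; last first.
      rewrite Y'E // => uY vY uv; rewrite -/E' -E'E ?(Y_lt im) //.
      exact: (pos_indY pos im).
    rewrite Y'm !mem_cat => uBD /orP[vB uv|/D_layer vL uv].
      rewrite -/E' -E'E ?(B_lt jm) //.
      case/orP: uBD => [uB|/D_layer]; first exact: (pos_indB pos jm).
      rewrite mem_layer => /andP[un /eqP uj].
      by have := pos_before pos jm vB un uj; rewrite ltnNge ltnW.
    move: vL; rewrite mem_layer => /andP[vn /eqP vj]; rewrite -/E' -E'E //.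
    rewrite /layered vj; case/orP: uBD => [->|/D_layer]; first by rewrite andbF.
    by rewrite mem_layer => /andP[_ ->].
  + move=> i; rewrite ltnS leq_eqVlt => /predU1P[->|im]; first by rewrite r'm.
    by rewrite r'E // (pos_rank pos).
  + move=> i; rewrite ltnS leq_eqVlt => /predU1P[->|im]; last first.
      by rewrite B'E // Y'E // r'E // layer'_old //; apply: (pos_inv pos).
    rewrite B'm Y'm r'm layer'_new size_iota size_cat natrD.
    apply: I_step (pos_inv pos jm) => //.
    * by rewrite ltr0n; apply: leq_trans S_gt0 S_le.
    * by rewrite -natrD ler_nat leq_add2l.
    * by apply: le_trans (grow k) _; rewrite ler_wpM2l ?ler_nat.
  + move=> i; rewrite ltnS leq_eqVlt => /predU1P[->|im]; last first.
      by rewrite r'E // layer'_old //; apply: (pos_size pos).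
    by rewrite r'm layer'_new size_iota.
(* The death of a single [v0] of rank [r j] already outweighs the [k.+1] fresh vertices of rank
   [(r j).+1]; no other old vertex gains weight. *)
- pose W i := ((Q * C ^ K).+1 ^ (K - i))%N.
  have [v0 v0S] : exists v0, v0 \in acc E' (n + k).
    by case: (acc E' (n + k)) S_gt0 => // v0 s _; exists v0; rewrite mem_head.
  have := D_layer _ (S_D _ v0S); rewrite mem_layer => /andP[v0n /eqP v0j].
  have v0_alive : ~~ dead (layered lab B) n v0.
    by apply: contra (acc_not_dead A_late v0S); apply: dead_E'.
  have v0_dead : dead E' (n + k.+1) v0.
    by have := S_D _ v0S; rewrite mem_filter => /andP[].
  rewrite {2}/weight [X in (_ < X)%N]big_mkcond /=.
  rewrite (bigD1_seq v0) ?iota_uniq ?mem_index_iota //= v0_alive v0j.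
  rewrite /weight (@big_cat_nat _ _ _ n) ?leq_addr //= addnC -/(W (r j)) -/E'.
  rewrite -addSn; apply: leq_add.
    apply: (@leq_ltn_trans (k.+1 * W (r j).+1)).
      have -> : (k.+1 * W (r j).+1 = \sum_(n <= v < n + k.+1) W (r j).+1)%N.
        by rewrite sum_nat_const_nat addKn.
      rewrite big_mkcond big_nat [leqRHS]big_nat /=.
      apply: leq_sum => v /andP[nv _]; case: ifP => // _.
      by rewrite -/(W _) /lab' ltnNge nv /= r'm.
    rewrite /W -(subnSK rj_lt) expnS ltn_pmul2r ?expn_gt0 // ltnS.
    apply: leq_trans k_le' _; rewrite leq_mul2l leq_pexp2l ?orbT //.
    by rewrite lt0n; apply: contraTneq k_le => ->; rewrite mul0n.
  rewrite -big_mkcondr big_nat_cond [leqRHS]big_nat_cond.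
  rewrite [leqLHS]big_mkcond [leqRHS]big_mkcond /=; apply: leq_sum => v _.
  case: ifP => // /andP[vn alive]; rewrite vn /=.
  have vn' : (v < n)%N by [].
  have -> : ~~ dead (layered lab B) n v by apply: contra alive; apply: dead_E'.
  have -> /= : v != v0 by apply: contraNneq alive => ->.
  by rewrite lab'E // r'E ?(pos_lab pos).
Qed.

End Visit.
(** Infinite descent on the weight: [visit] turns any position into a lighter one. *)
Lemma no_position n m lab B Y r : ~ position n m lab B Y r.
Proof.
have [w] := ubnP (weight n lab B r).
elim: w n m lab B Y r => // w IHw n m lab B Y r; rewrite ltnS => ww pos.
have [v0 v0n] : exists v0, v0 \in acc (layered lab B) n.
  have [+ _] := gap (acc_large B (pos_start pos) (pos_lab0 pos)).
  by case: (acc _ _) => // v s _; exists v; rewrite mem_head.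
have jm : (lab v0 < m)%N by apply: (pos_lab pos); apply: acc_ltn v0n.
have acc_j : {in acc (layered lab B) n, forall v, lab v = lab v0}.
  move=> v vn; apply: acc_same_layer vn v0n => u un x xB.
  by apply: (pos_dead pos (pos_lab pos un)); rewrite mem_cat xB.
have [n' [m' [lab' [B' [Y' [r' [pos']]]]]]] := visit pos jm acc_j.
by move=> lt_w; apply: IHw pos'; apply: leq_trans lt_w ww.
Qed.

Hypothesis I_first : forall b y u : R, I 0 b y u.

Lemma adversary_wins : False.
Proof.
apply: (@no_position Q 1 (fun=> 0%N) (fun=> [::]) (fun=> [::]) (fun=> 0%N)).
split=> // j; case: j => // _; rewrite expn0 muln1.
by rewrite /layer (leq_trans (size_subseq (filter_subseq _ _))) ?size_iota.
Qed.

End Adversary.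

(** * The recurrence on layer sizes and its rank bound *)

Section Ranks.
Set Implicit Arguments.
Unset Strict Implicit.
Variable R : realType.
Local Notation cs := (3 * Num.sqrt 3 / 2 : R).

(** The difference has a double root at [Num.sqrt 3], and its remaining root is negative. *)
Lemma cubic_ge_ratio (w : R) : 0 <= w -> cs * (w ^+ 2 - 1) <= w ^+ 3.
Proof.
move=> w0; have s2 : Num.sqrt 3 ^+ 2 = 3 :> R by rewrite sqr_sqrtr.
have s0 : 0 <= Num.sqrt 3 :> R by exact: sqrtr_ge0.
rewrite -subr_ge0.
have -> : w ^+ 3 - 3 * Num.sqrt 3 / 2 * (w ^+ 2 - 1)
  = (w - Num.sqrt 3) ^+ 2 * (w + Num.sqrt 3 / 2)
    + Num.sqrt 3 / 2 * (3 - Num.sqrt 3 ^+ 2) by field.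
rewrite s2 subrr mulr0 addr0.
by rewrite mulr_ge0 ?sqr_ge0 // addr_ge0 // divr_ge0.
Qed.

(* The state of a layer is [(b, y, u)]: [b] vertices of an independent set of
   dead vertices that the layer extends to one of size [u], and [y] vertices of
   the dead independent set that the next layer will extend. *)
Lemma rank_invariant (c : R) : 0 < c -> c < cs ->
  exists K (I : nat -> R -> R -> R -> Prop),
  [/\ forall b y u : R, I 0 b y u,
      forall k (b y u d u' : R), 0 <= b -> 0 < d -> b + d <= u -> u' <= c * d ->
        I k b y u -> I k.+1 y (b + d) u' &
      forall b y u : R, 0 <= b -> I K b y u -> u <= b].
Proof.
move=> c0 ccs; have cs0 : 0 < cs by apply: lt_trans ccs.
pose th := c / cs.
(* [t ^+ 3 >= th] by Bernoulli; both ratios [y / b] and [u / y] are bounded by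
   geometric sequences of ratio [t ^+ 2]. *)
pose t := (2 + th) / 3.
have th0 : 0 < th by rewrite divr_gt0.
have th1 : th < 1 by rewrite ltr_pdivrMr // mul1r.
have t0 : 0 < t by rewrite /t; lra.
have t1 : t < 1 by rewrite /t; lra.
have tht : th <= t ^+ 3.
  have -> : t ^+ 3 = th + (1 - th) ^+ 2 * (8 + th) / 27 by rewrite /t; field.
  rewrite lerDl divr_ge0 // mulr_ge0 ?sqr_ge0 //; lra.
(* Normalised so that [m 3 = c]: the crude bound [u' <= c * d <= c * (b + d)] then starts the
   sequence at ranks 1 and 2. *)
pose m k := c / t ^+ 6 * (t ^+ 2) ^+ k.
have m0 k : 0 < m k by rewrite mulr_gt0 ?divr_gt0 ?exprn_gt0.
have mS k : m k.+1 = t ^+ 2 * m k by rewrite /m (exprS _ k) mulrCA.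
have m3 : m 3 = c by rewrite /m -exprM; field; rewrite lt0r_neq0.
have m2 : c <= m 2.
  by rewrite -m3 mS ler_piMl ?(ltW (m0 _)) // expr_le1 // ltW.
pose I k b y u :=
  ((2 <= k)%N -> y <= m k * b) /\ ((1 <= k)%N -> u <= m k.+1 * y).
(* At such a [K] the two ratio bounds combine to [u <= m K.+1 * (m K * b) <= b]. *)
have [K K2 mK] : exists2 K, (2 <= K)%N & m K * m K.+1 <= 1.
  have : ((fun n => m n : R^o) @ \oo --> (0 : R^o))%classic.
    apply: (@cvg_geometric R (c / t ^+ 6) (t ^+ 2)).
    by rewrite ger0_norm ?exprn_ge0 ?expr_lt1 // ltW.
  move=> /cvgrPdist_lt/(_ 1 ltr01) [N _ mN].
  have mN1 k : m (N + k)%N <= 1.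
    have /mN /= : (N <= N + k)%N by exact: leq_addr.
    by rewrite sub0r normrN ger0_norm ?(ltW (m0 _)) // => /ltW.
  exists (N + 2)%N; first exact: leq_addl.
  by rewrite -addnS mulr_ile1 ?(ltW (m0 _)).
exists K, I; split.
- by [].
- move=> k b y u d u' b0 d0 bdu u'd [Iy Iu]; split=> [k1|_].
    by apply: le_trans bdu _; apply: Iu.
  have y'0 : 0 < b + d by lra.
  have cd : c * d <= c * (b + d) by rewrite ler_pM2l //; lra.
  case: k Iy Iu => [|[|k]] Iy Iu.
  + apply: le_trans (le_trans u'd cd) _; rewrite ler_pM2r //.
  + by apply: le_trans (le_trans u'd cd) _; rewrite m3.
  have {}Iy := Iy isT; have {}Iu := Iu isT; set n := k.+2 in Iy Iu *.
  apply: le_trans u'd _.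
  (* [w ^+ 2] is [m n * m n.+1], which bounds [(b + d) / b]. Hence [d] is at most [1 - 1 / w ^+ 2]
     times [b + d], and the cubic inequality turns [c * d] into at most [th * w * (b + d)]. *)
  pose w := t * m n; have w0 : 0 < w by rewrite mulr_gt0.
  have y'b : b + d <= w ^+ 2 * b.
    apply: le_trans bdu (le_trans Iu _).
    have -> : w ^+ 2 * b = m n.+1 * (m n * b) by rewrite (mS n) /w; ring.
    by rewrite ler_pM2l.
  have -> : m n.+2 = t ^+ 3 * w by rewrite (mS n.+1) (mS n) /w; ring.
  rewrite -(ler_pM2l (exprn_gt0 2 w0)).
  have : c * ((w ^+ 2 - 1) * (b + d)) <= th * w ^+ 3 * (b + d).
    rewrite mulrA ler_pM2r // {1}(_ : c = th * cs); last first.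
      by rewrite /th divfK // lt0r_neq0.
    by rewrite -mulrA ler_pM2l // cubic_ge_ratio // ltW.
  move=> h; apply: le_trans (le_trans h _).
    rewrite mulrCA ler_pM2l //; lra.
  have -> : w ^+ 2 * (t ^+ 3 * w * (b + d)) = t ^+ 3 * w ^+ 3 * (b + d) by ring.
  by rewrite !ler_pM2r // exprn_gt0.
- move=> b y u b0 [/(_ K2) Iy /(_ (ltnW K2)) Iu].
  apply: le_trans Iu _.
  apply: (@le_trans _ _ (m K.+1 * (m K * b))); first by rewrite ler_pM2l.
  by rewrite mulrA [m K.+1 * _]mulrC ler_piMl.
Qed.

End Ranks.

(** * Choice of the constants and conclusion *)

Lemma not_competitive (R : realType) (c : R) (A : algorithm) :
  c < 3 * Num.sqrt 3 / 2 -> late_accept_reject A -> ~ competitive c A.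
Proof.
set cs := 3 * _ / 2 => c_lt A_late [alpha A_comp].
have cs1 : 1 < cs.
  have : 1 <= Num.sqrt 3 :> R by rewrite -[leLHS]sqrtr1 ler_sqrt ?ler1n.
  by rewrite /cs; lra.
pose c1 := Num.max c 1; pose c' := (c1 + cs) / 2; pose a := `|alpha|.
have c1_ge1 : 1 <= c1 by rewrite le_max lexx orbT.
have c1_lt : c1 < cs by rewrite gt_max c_lt cs1.
have c'_gt0 : 0 < c' by rewrite /c'; lra.
have c'_lt : c' < cs by rewrite /c'; lra.
have [K [I [I0 IS IK]]] := rank_invariant c'_gt0 c'_lt.
(* From [s0] held vertices on, the slack [(c' - c1) * s] covers [a + 1]; taking [Q] above
   [c1 * s0 + a] forces that many. *)
pose s0 := (a + 1) / (c' - c1).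
have d_gt0 : 0 < c' - c1 by rewrite /c'; lra.
have a_ge0 : 0 <= a by exact: normr_ge0.
have s0_gt0 : 0 < s0 by rewrite divr_gt0 //; lra.
have A_comp1 n (G : graph n) : (OPT G)%:R <= c1 * (ALG A G)%:R + a.
  apply: le_trans (A_comp n G) _; rewrite lerD ?ler_norm //.
  by rewrite ler_wpM2r // le_max lexx.
have Q_gt := archi_boundP (_ : 0 <= c1 * s0 + a).
apply: (adversary_wins A_late A_comp1 (Q := Num.bound (c1 * s0 + a)) _
  (ltW c'_gt0) (ltW (archi_boundP (ltW c'_gt0))) IS IK I0).
move=> s Qs; have s0s : s0 <= s%:R.
  rewrite leNgt; apply/negP => s_lt.
  have : c1 * s%:R < c1 * s0 by rewrite ltr_pM2l //; lra.
  have /Q_gt : 0 <= c1 * s0 + a.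
    by rewrite addr_ge0 // mulr_ge0 // ltW // (lt_le_trans ltr01).
  lra.
split; first by rewrite -(ltr0n R); apply: lt_le_trans s0s.
have : a + 1 <= (c' - c1) * s%:R by rewrite mulrC -ler_pdivrMr.
by rewrite mulrBl; lra.
Qed.

Theorem theorem5 (R : realType) :
  ((3 * Num.sqrt 3 / 2)%:E <= competitive_ratio R)%E /\
  (forall c : R, c < 3 * Num.sqrt 3 / 2 ->
     forall A : algorithm, late_accept_reject A -> ~ competitive c A).
Proof.
split=> [|c c_lt A]; last exact: not_competitive.
apply/ereal_infP => _ [c [A A_late A_comp] <-]; rewrite lee_fin leNgt.
by apply/negP => c_lt; apply: (not_competitive c_lt A_late A_comp).
Qed.
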